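(* There exists a universal constant $K\in(0,\infty)$ such that for every $\varepsilon\in(0,1)$ there is $C_\varepsilon\in(0,\infty)$ for which property $\mathrm{P}(\varepsilon,K,C_\varepsilon)$ (defined in the context) holds. Moreover, for such $K$ and any choice of constants $(C_\varepsilon)_{\varepsilon\in(0,1)}$ such that $\mathrm{P}(\varepsilon,K,C_\varepsilon)$ holds for every $\varepsilon\in(0,1)$, there exists a universal constant $K'\in(0,\infty)$ (depending only on $K$) such that the following holds for every $\varepsilon\in(0,1)$ and every integer $k\ge 1$. Let $(X,d)$ be a compact metric space, and let $\mu_1,\ldots,\mu_k$ be Borel probability measures on $X$. Then there exist a compact subset $S\subseteq X$ and Borel probability measures $\nu_1,\ldots,\nu_k$ supported on $S$, such that $(S,d)$ embeds into an ultrametric space with distortion at most $(K'/\varepsilon)^k$ and for every $x\in X$ and $r\in[0,\infty)$ we have $$\nu_i\left(B_d(x,r)\right)\le\left(\mu_i\left(B_d(x,C_\varepsilon r)\right)\right)^{1-\varepsilon}\quad\text{for all } i\in\{1,\ldots,k\}.$$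
   Context: An ultrametric space is a metric space $(U,\rho)$ satisfying $\rho(x,y)\le\max\{\rho(x,z),\rho(y,z)\}$ for all $x,y,z\in U$. For $D\in[1,\infty)$, a metric space $(S,d)$ embeds with distortion $D$ into an ultrametric space if there exist an ultrametric space $(U,\rho)$ and an injection $f:S\to U$ with $d(x,y)\le\rho(f(x),f(y))\le D\,d(x,y)$ for all $x,y\in S$. Closed balls are denoted $B_d(x,r)=\{y\in X:\ d(y,x)\le r\}$ for $x\in X$, $r\in[0,\infty)$. A Borel probability measure $\nu$ on $X$ is supported on $S$ if $\nu(S)=1$. Property $\mathrm{P}(\varepsilon,K,C)$, for $\varepsilon\in(0,1)$ and $K,C\in(0,\infty)$: for every compact metric space $(X,d)$ and every Borel probability measure $\mu$ on $X$ there exist a compact subset $S\subseteq X$ such that $(S,d)$ embeds with distortion $K/\varepsilon$ into an ultrametric space, and a Borel probability measure $\nu$ supported on $S$ satisfying $\nu(B_d(x,r))\le\left(\mu(B_d(x,Cr))\right)^{1-\varepsilon}$ for all $x\in X$ and $r\in[0,\infty)$. *)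

(* Defs.v *)
From HB Require Import structures.
From mathcomp Require Import all_boot all_order all_algebra.
From mathcomp Require Import all_classical all_reals all_analysis.

Set Implicit Arguments.
Unset Strict Implicit.
Unset Printing Implicit Defensive.

Import Order.TTheory GRing.Theory Num.Theory.

Local Open Scope classical_set_scope.
Local Open Scope ring_scope.

(* The library equips generated sigma-algebras with a [measurableType]
   structure only on pointed types. A metric space carrying a probability
   measure is nonempty, so working with pointed metric spaces loses nothing;
   [point] plays no role below. *)
#[short(type="pmetricType")]
HB.structure Definition PointedMetric (R : numDomainType) :=
  {T of Pointed T & Metric R T}.

Definition borel (R : realType) (X : pmetricType R) :=
  g_sigma_algebraType (@open X).

(* Not [closed_ball], which is the closure of the open ball. *)
Definition cball (R : realType) (X : pmetricType R) (x : X) (r : R) : set X :=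
  [set y | mdist y x <= r].

Definition ultrametric (R : realType) (U : metricType R) : Prop :=
  forall x y z : U, mdist x y <= Num.max (mdist x z) (mdist y z).

Definition embeds_ultrametric (R : realType) (X : metricType R) (S : set X)
    (D : R) : Prop :=
  1 <= D /\
  exists U : metricType R, ultrametric U /\
  exists f : S -> U, injective f /\
    forall x y : S,
      mdist (\val x) (\val y) <= mdist (f x) (f y) <= D * mdist (\val x) (\val y).

Definition property_P (R : realType) (e K C : R) : Prop :=
  forall (X : pmetricType R) (mu : probability (borel X) R),
    compact [set: X] ->
  exists S : set X, [/\ compact S, embeds_ultrametric S (K / e) &
    exists nu : probability (borel X) R, nu S = 1%E /\
      forall (x : X) (r : R), 0 <= r ->
        (nu (cball x r) <= mu (cball x (C * r)) `^ (1 - e))%E].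

(* Main.v *)
Require Import Defs.
From HB Require Import structures.
From mathcomp Require Import all_boot all_order all_algebra.
From mathcomp Require Import all_classical all_reals all_analysis.
From mathcomp Require Import lra ring.

Set Implicit Arguments.
Unset Strict Implicit.
Unset Printing Implicit Defensive.

Import Order.TTheory GRing.Theory Num.Theory.
Import numFieldNormedType.Exports.

Local Open Scope classical_set_scope.
Local Open Scope ring_scope.

(* Fix an integer [t >= 1 / e] and radii [r_k = r_0 / 4 ^ k]. A fragment of level
   [k] is a Borel set [Y] with a density [w] such that [w ^ t * mu (Y ∩ B(c, r_k)) <= 1]
   for all [c]. Let [B(x, r_k / 2)] have the largest mass in [Y] among the balls of
   this radius, and let the radius grow from [r_k / 2] to [r_k] in [t] equal steps,
   from a ball [B_0] to a ball [B_t]. One of the steps, from [P] to [P'] say,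
   multiplies the mass by a factor [q] with [q ^ t <= mu (Y ∩ B_t) / mu (Y ∩ B_0)].
   Keep [Y ∩ P] with density [q * w], discard [Y ∩ P' \ P], and continue with the rest
   of [Y] and the density [w]. This preserves the total weight [w * mu Y] and
   produces sets at mutual distance at least [r_k / (2 t)]. As balls of radius
   [r_k / 4] have mass at most [mu (Y ∩ B_0)] in [Y], [Y ∩ P] is a fragment of level
   [k + 1], and as [w ^ t * mu (Y ∩ P') <= 1], its weight [w * mu (Y ∩ P')] is at most
   [mu (Y ∩ P') ^ (1 - 1 / t)]. The skeleton is the limit of the nested fragments,
   and its measure is the image of Lebesgue measure when the fragments are coded by
   nested intervals of [0, 1) whose lengths are their weights.

   For several measures, take the union of the skeletons: a set embeds with
   distortion [D] into an ultrametric space iff every chain with steps at most [s]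
   has its ends at distance at most [D * s], and if this holds for two sets with the
   constants [a] and [b], it holds for their union with [(a + 2) * (b + 2) - 2]. *)

(** * Chains and ultrametric embeddings *)

Definition metric_on (R : realType) (T : choiceType) (d : T -> T -> R)
  (d0 : forall x, d x x = 0) (dpos : forall x y, d x y = 0 -> x = y)
  (dC : forall x y, d x y = d y x)
  (dtri : forall y x z, d x z <= d x y + d y z) : Type := T.

HB.instance Definition _ (R : realType) (T : choiceType) d d0 dpos dC dtri :=
  Choice.copy (@metric_on R T d d0 dpos dC dtri) T.

HB.instance Definition _ (R : realType) (T : choiceType) d d0 dpos dC dtri :=
  @isMetric.Build R (@metric_on R T d d0 dpos dC dtri) d d0 dpos dC dtri.

Section Chains.
Variables (R : realType) (X : metricType R).
Implicit Types (S A B : set X) (s D : R) (x y z : X).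

Inductive chain S s : X -> X -> Prop :=
| chain_nil x : S x -> chain S s x x
| chain_cons x y z : S x -> mdist x y <= s -> chain S s y z -> chain S s x z.

Lemma chain_headP S s x y : chain S s x y -> S x.
Proof. by case. Qed.

Lemma chain_le S s s' x y : s <= s' -> chain S s x y -> chain S s' x y.
Proof.
move=> ss'; elim=> [{}x Sx|{}x {}y z Sx xy _]; first exact: chain_nil.
by apply: chain_cons => //; exact: le_trans ss'.
Qed.

Lemma chain_trans S s x y z : chain S s x y -> chain S s y z -> chain S s x z.
Proof.
by elim=> // {}x {}y w Sx xy _ IH /IH; exact: chain_cons.
Qed.

Lemma chain1 S s x y : S x -> S y -> mdist x y <= s -> chain S s x y.
Proof. by move=> Sx Sy xy; apply: chain_cons (chain_nil _ Sy). Qed.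

Lemma chain_sym S s x y : chain S s x y -> chain S s y x.
Proof.
elim=> [{}x Sx|{}x {}y z Sx xy yz IH]; first exact: chain_nil.
apply: chain_trans IH (chain1 _ Sx _); first exact: chain_headP yz.
by rewrite metric_sym.
Qed.

Definition stretch_le S D := forall s x y, 0 <= s ->
  chain S s x y -> mdist x y <= D * s.

(** The image of the chain has steps at most [D * s], and in an ultrametric space the ends of a
    chain are no further apart than its longest step. *)
Lemma embeds_ultrametric_stretch S D : embeds_ultrametric S D -> stretch_le S D.
Proof.
case=> D1 [U [ultraU [f [_ fP]]]] s x y s0 c.
suff H : forall (Sx : x \in S) (Sy : y \in S),
    mdist (f (SigSub Sx)) (f (SigSub Sy)) <= D * s.
  have Sx := mem_set (chain_headP c).
  have Sy := mem_set (chain_headP (chain_sym c)).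
  by apply: le_trans (H Sx Sy); case/andP: (fP (SigSub Sx) (SigSub Sy)).
have Ds : 0 <= D * s by rewrite mulr_ge0// (le_trans _ D1).
elim: c => [{}x _ Sx Sy|{}x {}y z _ xy yz IH Sx Sz].
  by rewrite (bool_irrelevance Sx Sy) mdistxx.
have Sy := mem_set (chain_headP yz).
apply: le_trans (ultraU _ _ (f (SigSub Sy))) _; rewrite ge_max; apply/andP; split.
  case/andP: (fP (SigSub Sx) (SigSub Sy)) => _ /le_trans; apply.
  by rewrite ler_wpM2l// (le_trans _ D1).
by rewrite metric_sym IH.
Qed.

(** On [S] this is the largest pseudo-ultrametric below the metric. Bounded stretch makes its
    multiple by [D] dominate the metric. *)
Definition subdominant S x y : R := inf [set s | 0 <= s /\ chain S s x y].

Section Subdominant.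
Variables (S : set X) (D : R).
Hypotheses (D1 : 1 <= D) (SD : stretch_le S D).
Let rho (x y : S) : R := D * subdominant S (\val x) (\val y).

Let Sval (x : S) : S (\val x).
Proof. exact: set_mem (valP x). Qed.

Let lbS x y : has_lbound [set s | 0 <= s /\ chain S s x y].
Proof. by exists 0 => s []. Qed.

Let D0 : 0 < D. Proof. exact: lt_le_trans D1. Qed.

Lemma le_subdominant (x y : S) : mdist (\val x) (\val y) <= rho x y.
Proof.
rewrite /rho -ler_pdivrMl//; apply: lb_le_inf.
  exists (mdist (\val x) (\val y)); split; first exact: mdist_ge0.
  exact: chain1.
by move=> s [s0 /(SD s0)]; rewrite ler_pdivrMl.
Qed.

Lemma subdominant_le (x y : S) : rho x y <= D * mdist (\val x) (\val y).
Proof.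
rewrite ler_pM2l//; apply: ge_inf => //.
by split; [exact: mdist_ge0|exact: chain1].
Qed.

Lemma subdominantxx (x : S) : rho x x = 0.
Proof.
apply/eqP; rewrite eq_le (le_trans (subdominant_le x x)) ?mdistxx ?mulr0//=.
by rewrite (le_trans _ (le_subdominant x x)) ?mdist_ge0.
Qed.

Lemma subdominant_eq0 (x y : S) : rho x y = 0 -> x = y.
Proof.
move=> xy; apply/val_inj/mdist_positivity/eqP.
by rewrite eq_le mdist_ge0 andbT -xy le_subdominant.
Qed.

Lemma subdominant_sym (x y : S) : rho x y = rho y x.
Proof.
congr (_ * inf _); apply/seteqP.
by split=> s [s0 /chain_sym].
Qed.

Lemma subdominant_ultra (x y z : S) : rho x y <= Num.max (rho x z) (rho y z).
Proof.
rewrite (subdominant_sym y) -maxr_pMr ?ler_pM2l ?(ltW D0)//.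
apply/ler_addgt0Pr => e e0.
have adh (u v : S) : exists2 s, chain S s (\val u) (\val v) &
    0 <= s < subdominant S (\val u) (\val v) + e.
  have [|s [s0 c] se] := @inf_adherent _ [set s | 0 <= s /\ chain S s (\val u) (\val v)] _ e0.
    split=> //; exists (mdist (\val u) (\val v)); split; first exact: mdist_ge0.
    exact: chain1.
  by exists s => //; rewrite s0.
have [s cs /andP[s0 se]] := adh x z; have [r cr /andP[r0 re]] := adh z y.
have [sm rm] : s <= Num.max s r /\ r <= Num.max s r.
  by rewrite !le_max !lexx orbT.
apply: (@le_trans _ _ (Num.max s r)).
  apply: ge_inf; first exact: lbS.
  split; first exact: le_trans sm.
  exact: chain_trans (chain_le sm cs) (chain_le rm cr).
by rewrite addr_maxl ge_max !le_max (ltW se) (ltW re) orbT.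
Qed.

Lemma subdominant_triangle (y x z : S) : rho x z <= rho x y + rho y z.
Proof.
have r0 u v : 0 <= rho u v by apply: le_trans (le_subdominant u v); exact: mdist_ge0.
by apply: le_trans (subdominant_ultra _ _ y) _; rewrite ge_max lerDl r0 (subdominant_sym z) lerDr r0.
Qed.

Lemma stretch_embeds_ultrametric : embeds_ultrametric S D.
Proof.
split=> //.
exists (metric_on subdominantxx subdominant_eq0 subdominant_sym subdominant_triangle).
split; first exact: subdominant_ultra.
by exists id; split=> // x y; rewrite le_subdominant subdominant_le.
Qed.
End Subdominant.

(* Contracting the maximal runs of a chain that lie in [B] leaves a chain in [A]
   whose steps are at most [(b + 2) s]. *)
Lemma stretch_leU A B a b : 0 <= a -> 0 <= b -> stretch_le A a -> stretch_le B b ->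
  stretch_le (A `|` B) ((a + 2) * (b + 2) - 2).
Proof.
move=> a0 b0 Aa Bb s x y s0 c.
have as0 : 0 <= a * s by rewrite mulr_ge0.
have bs0 : 0 <= b * s by rewrite mulr_ge0.
have abs0 : 0 <= a * (b * s) by rewrite mulr_ge0.
(* Unless the chain runs in [B], [u] and [v] are its first and last points counted in [A]. The form
   of [xu] lets a run in [B] be extended to the left at no cost. The bound is [a * (b + 2) + 2 * (b
   + 1) = (a + 2) * (b + 2) - 2]. *)
suff [/(Bb _ _ _ s0) xy|[u [v [uv xu]]]] : chain B s x y \/
    exists u v, [/\ chain A ((b + 2) * s) u v,
      x = u \/ exists2 z, chain B s x z & mdist z u <= s &
      mdist v y <= (b + 1) * s].
- by lra.
- have bs2 : 0 <= (b + 2) * s by lra.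
  have uvs := Aa _ _ _ bs2 uv; move=> vy.
  have {}xu : mdist x u <= (b + 1) * s.
    case: xu => [->|[z /(Bb _ _ _ s0) xz zu]]; first by rewrite mdistxx; lra.
    by have := metric_triangle x z u; lra.
  have := metric_triangle x u y; have := metric_triangle u v y; lra.
elim: c => [{}x [Ax|Bx]|{}x {}y z ABx xy yz IH].
- right; exists x, x; split; [exact: chain_nil|by left|].
  by rewrite mdistxx; lra.
- by left; exact: chain_nil.
case: IH => [By|[u [v [uv yu vz]]]].
  case: ABx => [Ax|Bx]; last by left; exact: chain_cons xy By.
  right; exists x, x; split; [exact: chain_nil|by left|].
  by have := Bb _ _ _ s0 By; have := metric_triangle x y z; lra.
right; case: ABx => [Ax|Bx].
  exists x, v; split=> //; last by left.
  apply: chain_cons uv => //.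
  case: yu => [<-|[w /(Bb _ _ _ s0) yw wu]]; first by lra.
  by have := metric_triangle x y u; have := metric_triangle y w u; lra.
exists u, v; split=> //; right; case: yu => [<-|[w yw wu]].
  by exists x => //; exact: chain_nil.
by exists w => //; exact: chain_cons xy yw.
Qed.
End Chains.

Lemma embeds_ultrametricU (R : realType) (X : metricType R) (A B : set X) (a b : R) :
  embeds_ultrametric A a -> embeds_ultrametric B b ->
  embeds_ultrametric (A `|` B) ((a + 2) * (b + 2) - 2).
Proof.
move=> eA eB; have [a1 _] := eA; have [b1 _] := eB.
apply: stretch_embeds_ultrametric; first by nra.
by apply: stretch_leU; try lra; exact: embeds_ultrametric_stretch.
Qed.

(** After adding 2, the constants of a union simply multiply. *)
Lemma embeds_ultrametric_bigU (R : realType) (X : metricType R) (D : R) (k : nat)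
    (S : nat -> set X) : (forall i, (i <= k)%N -> embeds_ultrametric (S i) D) ->
  embeds_ultrametric (\bigcup_(i < k.+1) S i) ((D + 2) ^+ k.+1 - 2).
Proof.
elim: k => [|k IH] SD.
  by rewrite bigcup_mkord big_ord1 expr1 addrK; exact: SD.
rewrite bigcup_mkord big_ord_recr -bigcup_mkord /=.
have := embeds_ultrametricU (IH (fun i ik => SD i (leqW ik))) (SD _ (leqnn _)).
by rewrite subrK -exprSr.
Qed.

(** * Borel sets, finite nets and masses of balls *)

Section BorelMeasure.
Variables (R : realType) (X : pmetricType R).
Implicit Types (A B Y : set X) (x c : X) (r : R).

Lemma closed_cball x r : closed (cball x r).
Proof.
rewrite -[cball x r]setCK; apply: open_closedC; rewrite openE => y /= /negP.
rewrite -ltNge => ry; rewrite /interior -nbhs_ballE /=.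
exists (mdist y x - r); first by rewrite /= subr_gt0.
move=> z; rewrite ballEmdist /= => yz; apply/negP; rewrite -ltNge.
by have := metric_triangle y z x; lra.
Qed.

Lemma closed_borel A : closed A -> measurable (A : set (borel X)).
Proof.
move=> /closed_openC oA; rewrite -[A]setCK; apply: measurableC.
by apply: sub_gen_smallest.
Qed.

Lemma cball_borel x r : measurable (cball x r : set (borel X)).
Proof. by apply: closed_borel; exact: closed_cball. Qed.

Lemma cball_sub x c r r' : mdist x c + r <= r' -> cball x r `<=` cball c r'.
Proof. by move=> xc y; rewrite /cball /= => yx; have := metric_triangle y x c; lra. Qed.

Lemma finite_net : compact [set: X] -> forall d : R, 0 < d ->
  exists s : seq X, forall c, exists2 x, x \in s & mdist c x <= d.
Proof.
rewrite compact_cover => cX d d0.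
have [||D _ XD] := cX X setT (fun x => (ball x d)^°).
- by move=> x _; exact: open_interior.
- by move=> x _; exists x => //; exact: nbhsx_ballx.
exists (finmap.enum_fset D) => c; have [x xD] := XD c I; move/interior_subset.
by rewrite ballEmdist /= metric_sym => /ltW; exists x.
Qed.

Variable mu : probability (borel X) R.

Definition mass (A : set X) : R := fine (mu A).

Lemma massE A : measurable (A : set (borel X)) -> mu A = (mass A)%:E.
Proof. by move=> mA; rewrite fineK// fin_num_measure. Qed.

Lemma mass_ge0 A : 0 <= mass A.
Proof. by rewrite fine_ge0. Qed.

Lemma mass0 : mass set0 = 0.
Proof. by rewrite /mass measure0. Qed.

Lemma massT : mass setT = 1.
Proof. by rewrite /mass probability_setT. Qed.

Lemma mass_le A B : measurable (A : set (borel X)) -> measurable (B : set (borel X)) ->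
  A `<=` B -> mass A <= mass B.
Proof.
by move=> mA mB AB; rewrite -lee_fin -!massE//; apply: le_measure; rewrite ?inE.
Qed.

Lemma mass_le1 A : measurable (A : set (borel X)) -> mass A <= 1.
Proof. by move=> mA; rewrite -massT; apply: mass_le. Qed.

Lemma mass_D A B : measurable (A : set (borel X)) -> measurable (B : set (borel X)) ->
  B `<=` A -> mass (A `\` B) = mass A - mass B.
Proof.
move=> mA mB BA; apply: EFin_inj; rewrite EFinB -!massE//; last exact: measurableD.
rewrite measureD//; first by rewrite setIidr.
by rewrite ltey_eq fin_num_measure.
Qed.

Lemma mass_cover0 Y (s : seq X) r : measurable (Y : set (borel X)) ->
  (forall c, exists2 x, x \in s & mdist c x <= r) ->
  (forall x, x \in s -> mass (Y `&` cball x r) = 0) -> mass Y = 0.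
Proof.
move=> mY sr s0; apply/eqP; rewrite eq_le mass_ge0 andbT -lee_fin -massE//.
have mYs x : measurable (Y `&` cball x r : set (borel X)).
  by apply: measurableI => //; exact: cball_borel.
suff -> : Y = \big[setU/set0]_(x <- s) (Y `&` cball x r).
  elim: s s0 {sr} => [|x s IH] s0; first by rewrite big_nil measure0.
  rewrite big_cons; apply: le_trans (measureU2 _ _ _) _ => //.
    exact: bigsetU_measurable.
  rewrite -[leRHS]adde0; apply: leeD; last first.
    by apply: IH => y ys; rewrite s0// in_cons ys orbT.
  have : mu (Y `&` cball x r) = 0%E by rewrite massE// s0// mem_head.
  by move=> mu0; apply: (eq_ind_r (fun a => (a <= _)%E) (lexx _) mu0).
apply/seteqP; split=> y; rewrite -bigcup_seq.
  by move=> Yy; have [x xs yx] := sr y; exists x.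
by case=> x _ [].
Qed.
End BorelMeasure.

(** * Fragmentation at one scale *)

Lemma seq_argmax (R : realType) (T : eqType) (f : T -> R) (s : seq T) (x0 : T) :
  x0 \in s -> exists2 x, x \in s & forall y, y \in s -> f y <= f x.
Proof.
elim: s x0 => // a [|b s] IH x0 _.
  by exists a => [|y]; rewrite inE // => /eqP ->.
have [x xs xP] := IH b (mem_head _ _).
have [ax|xa] := leP (f a) (f x).
  exists x; first by rewrite in_cons xs orbT.
  by move=> y; rewrite in_cons => /orP[/eqP ->//|/xP].
exists a; first exact: mem_head.
move=> y; rewrite in_cons => /orP[/eqP ->//|/xP yx].
exact: le_trans (ltW xa).
Qed.

Lemma count_lt (T : eqType) (p q : pred T) (s : seq T) (x : T) :
  subpred p q -> x \in s -> q x -> ~~ p x -> (count p s < count q s)%N.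
Proof.
move=> pq xs qx px; have -> : count p s = count p [seq y <- s | q y].
  by rewrite count_filter; apply: eq_count => y /=; case: (boolP (p y)) => // /pq.
rewrite -[count q s]size_filter ltn_neqAle count_size andbT.
apply/negP; rewrite -all_count => /allP/(_ x); rewrite mem_filter qx xs.
by move=> /(_ isT); apply/negP.
Qed.

(* Pigeonhole on the ratios [b i.+1 / b i], whose product telescopes. *)
Lemma slow_growth (R : realType) (b : nat -> R) (t : nat) : (0 < t)%N ->
  (forall i, 0 < b i) ->
  exists2 i, (i < t)%N & b i.+1 ^+ t * b 0%N <= b t * b i ^+ t.
Proof.
move=> t0 b0; apply: contrapT => H.
have {}H i : (i < t)%N -> b t * b i ^+ t < b i.+1 ^+ t * b 0%N.
  by move=> it; rewrite ltNge; apply/negP => bi; apply: H; exists i.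
(* This is [(b t / b 0) ^ n < (b n / b 0) ^ t] without denominators; at [n = t] both sides are
   equal. *)
suff /(_ t) : forall n, (0 < n <= t)%N ->
    b t ^+ n * b 0%N ^+ t < b n ^+ t * b 0%N ^+ n.
  by rewrite t0 leqnn ltxx => /(_ isT).
have bX i n : 0 < b i ^+ n by rewrite exprn_gt0.
elim=> // n IH /= nt; have := H n nt.
rewrite -(ltr_pM2r (bX 0%N n)) => Hn.
have -> : b n.+1 ^+ t * b 0%N ^+ n.+1 = b n.+1 ^+ t * b 0%N * b 0%N ^+ n.
  by rewrite exprS mulrA.
apply: le_lt_trans Hn; rewrite exprS -!mulrA ler_pM2l//.
by case: n IH nt => [|n] IH nt; [rewrite !expr0 mul1r mulr1|apply/ltW/IH/ltnW].
Qed.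

Section Fragmentation.
Variables (R : realType) (X : pmetricType R) (mu : probability (borel X) R).
Variable t : nat.
Hypothesis t_gt0 : (0 < t)%N.
Local Notation m := (mass mu).

(* A fragment is a Borel set together with the constant density, relative to
   [mu], of the measure it carries. *)
Definition fragment : Type := set X * R.

Definition weight_of (Y : fragment) : R := Y.2 * m Y.1.

Definition light (r : R) (Y : fragment) :=
  [/\ measurable (Y.1 : set (borel X)), 0 <= Y.2 &
      forall c, Y.2 ^+ t * m (Y.1 `&` cball c r) <= 1].

(** As the default of [nth], it satisfies every condition on a child, so that child indices need no
    bound. *)
Definition frag0 : fragment := (set0, 0).

(** The inequality in [frag_cball] bounds the weight by the mass to the power [1 - 1 / t], written
    with natural exponents. *)
Record fragmentation (r : R) (Y : fragment) (l : seq fragment) : Prop := {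
  frag_light : forall i, light (r / 4) (nth frag0 l i);
  frag_sub : forall i, (nth frag0 l i).1 `<=` Y.1;
  frag_cball : forall i, exists2 c, (nth frag0 l i).1 `<=` cball c r &
    weight_of (nth frag0 l i) ^+ t <= m (cball c r) ^+ t.-1;
  frag_sep : forall i j, i <> j -> forall x y,
    (nth frag0 l i).1 x -> (nth frag0 l j).1 y -> r / (2 * t%:R) <= mdist x y;
  frag_weight : \sum_(P <- l) weight_of P = weight_of Y }.

Lemma light0 r : light r frag0.
Proof. by split=> //= c; rewrite expr0n gtn_eqF// mul0r. Qed.

Lemma fragmentation_nil r Y : m Y.1 = 0 -> fragmentation r Y [::].
Proof.
move=> Y0; split.
- by move=> i; rewrite nth_nil; exact: light0.
- by move=> i; rewrite nth_nil.
- move=> i; rewrite nth_nil; exists point => //.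
  by rewrite /weight_of /= mul0r expr0n gtn_eqF// exprn_ge0// mass_ge0.
- by move=> i j _ x y; rewrite nth_nil.
- by rewrite big_nil /weight_of Y0 mulr0.
Qed.

(* Carve out a concentric pair of balls whose mass ratio is small around the centre
   [x] of largest mass, keep the inner one, and discard the annulus; since [x] is
   optimal, [light] passes to the inner ball at a quarter of the radius. *)
Lemma exists_fragmentation r Y : compact [set: X] -> 0 < r -> light r Y ->
  exists l, fragmentation r Y l.
Proof.
move=> cX r0; have [s sP] := finite_net cX (divr_gt0 r0 (ltr0n _ 4)).
pose active (Z : set X) x := 0 < m (Z `&` cball x (r / 2)).
(* Induction on the number of active net points: the chosen centre [x] becomes inactive once [P'] is
   removed. With no active point left, [Y] is null. *)
have [n] := ubnP (count (active Y.1) s); elim: n Y => // n IH [Y w] /= sn [mY w0 Yw].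
rewrite /= in mY w0 Yw.
have mYc x q : measurable (Y `&` cball x q : set (borel X)).
  by apply: measurableI => //; exact: cball_borel.
have [[z zs zP]|no] := pselect (exists2 z, z \in s & active Y z); last first.
  exists [::]; apply: fragmentation_nil; apply: (@mass_cover0 _ _ _ _ s (r / 2)) => //=.
    by move=> c; have [x xs cx] := sP c; exists x => //; lra.
  move=> x xs; apply/eqP; rewrite eq_le mass_ge0 andbT leNgt; apply/negP => ax.
  by apply: no; exists x.
have [x xs xmax] := seq_argmax (fun x => m (Y `&` cball x (r / 2))) zs.
pose rad (i : nat) := r / 2 + i%:R * (r / (2 * t%:R)).
have tR : 0 < t%:R :> R by rewrite ltr0n.
have step0 : 0 < r / (2 * t%:R) by rewrite divr_gt0// mulr_gt0.
have rad0 : rad 0%N = r / 2 by rewrite /rad mul0r addr0.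
have radt : rad t = r by rewrite /rad; field; rewrite gt_eqF.
have radS i : rad i.+1 = rad i + r / (2 * t%:R) by rewrite /rad -natr1; ring.
have rad_le i j : (i <= j)%N -> rad i <= rad j.
  by move=> ij; rewrite lerD2l ler_wpM2r ?ler_nat// ltW.
pose b i := m (Y `&` cball x (rad i)).
have b_le i j : (i <= j)%N -> b i <= b j.
  move=> /rad_le ij; apply: mass_le => //; apply: setIS.
  by apply: cball_sub; rewrite mdistxx add0r.
have b0 i : 0 < b i.
  apply: lt_le_trans (b_le 0%N i isT); rewrite /b rad0.
  by apply: lt_le_trans (xmax z zs).
have [i it bi] := slow_growth t_gt0 b0.
have bw j : (j <= t)%N -> w ^+ t * b j <= 1.
  move=> jt; apply: le_trans (Yw x); rewrite ler_wpM2l ?exprn_ge0//.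
  by rewrite -radt; exact: b_le.
pose P := Y `&` cball x (rad i); pose P' := Y `&` cball x (rad i.+1).
pose v := w * b i.+1 / b i.
have v0 : 0 <= v by rewrite /v !mulr_ge0 ?invr_ge0 ?(ltW (b0 _)).
have mQ : measurable (Y `\` P' : set (borel X)) by apply: measurableD; [exact: mY|exact: mYc].
have [||l lP] := IH (Y `\` P', w).
- rewrite /=; apply: leq_trans (_ : count (active Y) s <= n)%N; last by rewrite -ltnS.
  apply: (count_lt (x := x)) => //.
  + move=> y; rewrite /active => /lt_le_trans; apply; apply: mass_le => //.
      by apply: measurableI => //; exact: cball_borel.
    by apply: setSI; exact: subDsetl.
  + by rewrite /active -rad0; exact: (b0 0%N).
  + rewrite /active -leNgt [X in m X](_ : _ = set0) ?mass0//.
    apply/seteqP; split=> // y [[Yy nP'] xy]; apply: nP'; split=> //=.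
    by apply: le_trans xy _; rewrite -rad0; exact: rad_le.
- split=> //= c; apply: le_trans (Yw c); rewrite ler_wpM2l ?exprn_ge0//.
  apply: mass_le => //; first by apply: measurableI => //; exact: cball_borel.
  by apply: setSI; exact: subDsetl.
have PQ j y z' : P y -> (nth frag0 l j).1 z' -> r / (2 * t%:R) <= mdist y z'.
  move=> [_ /= yx] /(frag_sub lP) /= [Yz nP'].
  have zx : rad i.+1 < mdist z' x by rewrite ltNge; apply/negP => zx; apply: nP'.
  move: yx zx; rewrite /cball /= radS.
  by have := metric_triangle z' y x; rewrite (metric_sym z' y); lra.
have weightP : weight_of (P, v) = w * b i.+1.
  by rewrite /weight_of /= -/(b i) /v mulfVK// gt_eqF.
exists ((P, v) :: l); split.
- case=> [|j]; last exact: (frag_light lP).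
  split; [exact: mYc|exact: v0|move=> c]; have [y ys cy] := sP c.
  (* [B(c, r / 4)] lies in [B(y, r / 2)] for a net point [y], so by the choice of [x] its mass in
     [Y] is at most [b 0]. Slow growth then gives [v ^ t * b 0 <= w ^ t * b t <= 1]. *)
  apply: (@le_trans _ _ (v ^+ t * b 0%N)).
    apply: ler_wpM2l; first exact: exprn_ge0.
    rewrite /b rad0; apply: le_trans (xmax y ys).
    apply: mass_le; [|exact: mYc|].
      by apply: measurableI; [exact: mYc|exact: cball_borel].
    apply: setISS; first exact: subIsetl.
    by apply: cball_sub; lra.
  apply: le_trans (bw t (leqnn t)).
  rewrite /v !exprMn exprVn -!mulrA ler_wpM2l ?exprn_ge0//.
  rewrite mulrCA ler_pdivrMl ?exprn_gt0// mulrC [b i ^+ t * _]mulrC.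
  by rewrite mulrC.
- case=> [|j] /=; first exact: subIsetl.
  by move=> y /(frag_sub lP) [].
- case=> [|j]; last exact: (frag_cball lP).
  exists x => /=.
    move=> y [_]; apply: cball_sub.
    by rewrite mdistxx add0r -radt rad_le// ltnW.
  (* One factor [b i.+1] is absorbed by [w ^ t * b i.+1 <= 1]; the other [t - 1] remain. *)
  rewrite weightP exprMn -{2}(prednK t_gt0) exprS mulrA.
  rewrite -[leRHS]mul1r ler_pM ?mulr_ge0 ?exprn_ge0 ?(ltW (b0 _))//.
    exact: bw.
  rewrite lerXn2r ?nnegrE ?mass_ge0//.
  apply: mass_le => //; first exact: cball_borel.
  move=> y [_]; apply: cball_sub.
  by rewrite mdistxx add0r -radt rad_le.
- case=> [|j] [|k] jk y z' //=; [exact: PQ| |].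
    by rewrite metric_sym => yl zP'; exact: PQ zP' yl.
  by apply: (frag_sep lP) => jk'; apply: jk; rewrite jk'.
- rewrite big_cons (frag_weight lP) weightP /weight_of /= mass_D//; [|exact: mYc|exact: subIsetl].
  by rewrite -/(b i.+1); ring.
Qed.
End Fragmentation.

(** * The tree of fragments, its skeleton and the measure on it *)

Lemma closure_mdistP (R : realType) (X : metricType R) (A : set X) (x : X) :
  closure A x <-> forall e, 0 < e -> exists2 y, A y & mdist x y < e.
Proof.
split=> [cA e e0|H B].
  have [y [Ay]] := cA _ (nbhsx_ballx x _ e0).
  by rewrite ballEmdist; exists y.
rewrite -nbhs_ballE => -[e /= e0 eB]; have [y Ay xy] := H e e0.
by exists y; split=> //; apply: eB; rewrite ballEmdist.
Qed.

(** A probability on the whole line concentrated on [0, 1), so that the coding map can be total on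
    the reals. *)
Definition lebesgue01 (R : realType) : set (measurableTypeR R) -> \bar R :=
  mrestr (@lebesgue_measure R) (measurable_itv `[0, 1[).

HB.instance Definition _ (R : realType) := Measure.copy (@lebesgue01 R)
  (mrestr (@lebesgue_measure R) (measurable_itv `[0, 1[)).

Lemma lebesgue01_setT (R : realType) : @lebesgue01 R setT = 1%E.
Proof.
rewrite /lebesgue01 /mrestr setTI lebesgue_measure_itv /= lte_fin ltr01.
by rewrite -EFinB subr0.
Qed.

HB.instance Definition _ (R : realType) :=
  Measure_isProbability.Build _ (measurableTypeR R) R (@lebesgue01 R) (lebesgue01_setT R).

Section Tree.
Variables (R : realType) (X : pmetricType R) (mu : probability (borel X) R).
Variables (t : nat) (r0 : R).
Hypotheses (t_gt0 : (0 < t)%N) (r0_gt0 : 0 < r0).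
Hypothesis cX : compact [set: X].
Hypothesis diamX : forall x y : X, mdist x y <= r0.

Definition rad (k : nat) : R := r0 / 4 ^+ k.

Variable F : nat -> fragment X -> seq (fragment X).
Hypothesis FP : forall k Y, light mu t (rad k) Y ->
  fragmentation mu t (rad k) Y (F k Y).

(* A node of depth [k] is the list of child indices leading to it, last index first. *)
Fixpoint frag (p : seq nat) : fragment X :=
  if p is i :: q then nth (frag0 X) (F (size q) (frag q)) i else (setT, 1).

Definition weight (p : seq nat) : R := weight_of mu (frag p).

(** Left end of the interval coding [p]: the intervals of the children are laid side by side from
    the left end of the parent's, and fill it because weight is preserved. *)
Fixpoint start (p : seq nat) : R :=
  if p is i :: q then start q + \sum_(0 <= j < i) weight (j :: q) else 0.

Definition cell (p : seq nat) : set R :=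
  [set u | start p <= u < start p + weight p].

(** Fragments are only Borel. Closing them keeps limit points, and preserves both the separation and
    the inclusion in closed balls. *)
Definition piece (p : seq nat) : set X := closure (frag p).1.

Lemma rad_gt0 k : 0 < rad k.
Proof. by rewrite divr_gt0// exprn_gt0. Qed.

Lemma radS k : rad k.+1 = rad k / 4.
Proof. by rewrite /rad exprSr invfM mulrA. Qed.

(** Take the least [k] with [2 * rad k < d]; [d <= 2 * r0] excludes [k = 0], and minimality gives
    [d <= 2 * rad k.-1]. The factor 2 matches the diameter bound for pieces. *)
Lemma rad_scale (d : R) : 0 < d <= 2 * r0 -> exists k, 2 * rad k < d <= 8 * rad k.
Proof.
move=> /andP[d0 dr].
have ex : exists k, 2 * rad k < d.
  exists (Num.truncn (2 * r0 / d)).+1; set n := _.+1.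
  rewrite /rad mulrA ltr_pdivrMr ?exprn_gt0// -ltr_pdivrMl// mulrC.
  apply: lt_le_trans (truncnS_gt _) _; rewrite -natrX ler_nat -/n.
  by apply: ltnW; apply: ltn_expl.
have [[|k] kd kmin] := ex_minnP ex.
  by move: kd; rewrite /rad expr0 divr1; lra.
exists k.+1; rewrite kd /=; have : ~~ (2 * rad k < d).
  by apply/negP => /kmin; rewrite ltnn.
by rewrite radS -leNgt; lra.
Qed.

Lemma frag_light_path p : light mu t (rad (size p)) (frag p).
Proof.
elim: p => [|i p IH] /=.
  split=> //= c; rewrite expr1n mul1r mass_le1//.
  by rewrite setTI; exact: cball_borel.
by rewrite radS; exact: (frag_light (FP IH)).
Qed.

Lemma frag_path p : fragmentation mu t (rad (size p)) (frag p) (F (size p) (frag p)).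
Proof. exact/FP/frag_light_path. Qed.

Lemma weight_ge0 p : 0 <= weight p.
Proof.
by case: (frag_light_path p) => _ w0 _; rewrite mulr_ge0// mass_ge0.
Qed.

Lemma sum_weight p n : \sum_(0 <= i < n) weight (i :: p) <= weight p.
Proof.
rewrite -[leRHS](frag_weight (frag_path p)) (big_nth (frag0 X)).
set N := size _; have [nN|Nn] := leqP n N.
  rewrite [leRHS](big_cat_nat (leq0n n) nN) /= lerDl sumr_ge0// => i _.
  exact: (weight_ge0 (i :: p)).
rewrite [leLHS](big_cat_nat (leq0n N) (ltnW Nn)) /= gerDl.
rewrite big_nat big1// => i /andP[Ni _].
by rewrite /weight /= nth_default// /weight_of mul0r.
Qed.

Lemma sum_weight_eq p : exists n, \sum_(0 <= i < n) weight (i :: p) = weight p.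
Proof.
exists (size (F (size p) (frag p))).
by rewrite -[RHS](frag_weight (frag_path p)) (big_nth (frag0 X)).
Qed.

Lemma start_next p i : start (i :: p) + weight (i :: p) = start (i.+1 :: p).
Proof. by rewrite /= big_nat_recr//= addrA. Qed.

Lemma start_le p i j : (i <= j)%N -> start (i :: p) <= start (j :: p).
Proof.
move=> ij; rewrite /= lerD2l (big_cat_nat (leq0n i) ij) /= lerDl.
by rewrite sumr_ge0// => k _; exact: weight_ge0.
Qed.

Lemma cell_parent i p : cell (i :: p) `<=` cell p.
Proof.
move=> u; rewrite /cell /mkset start_next => /andP[iu ui].
apply/andP; split.
  by apply: le_trans iu; rewrite /= lerDl sumr_ge0// => k _; exact: weight_ge0.
by apply: lt_le_trans ui _; rewrite /= lerD2l sum_weight.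
Qed.

(** Finitely many children exhaust the weight of [p]; the first one whose interval ends after [u]
    contains [u]. *)
Lemma cell_child p u : cell p u -> exists i, cell (i :: p) u.
Proof.
move=> /andP[pu up]; have ex : exists i, u < start (i.+1 :: p).
  have [[|n] nE] := sum_weight_eq p.
    by move: nE up; rewrite big_geq// => <-; lra.
  by exists n; rewrite /= nE.
have [i ui imin] := ex_minnP ex.
exists i; rewrite /cell /mkset start_next ui andbT.
case: i ui imin => [|i] ui imin; first by rewrite /= big_geq// addr0.
by rewrite leNgt; apply/negP => /imin; rewrite ltnn.
Qed.

Lemma cell_inj p q u : size p = size q -> cell p u -> cell q u -> p = q.
Proof.
elim: p q => [|i p IH] [|j q] //= [pq] ui uj.
have {}IH : p = q by apply: IH => //; apply: cell_parent; eassumption.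
subst q; congr (_ :: _); move: ui uj; rewrite /cell /mkset !start_next.
move=> /andP[iu ui] /andP[ju uj].
have [/(start_le p) ij|/(start_le p) ji|//] := ltngtP i j.
  by move: (lt_le_trans ui ij); rewrite ltNge ju.
by move: (lt_le_trans uj ji); rewrite ltNge iu.
Qed.

Lemma cell_nonempty p u : cell p u -> (frag p).1 !=set0.
Proof.
move=> /andP[pu up]; apply/set0P/negP => /eqP p0.
by move: up; rewrite /weight /weight_of p0 mass0 mulr0 addr0 ltNge pu.
Qed.

Lemma cell_nil u : cell [::] u = (0 <= u < 1).
Proof. by rewrite /cell /mkset /weight /weight_of /= massT mulr1 add0r. Qed.

Lemma cell01 p u : cell p u -> 0 <= u < 1.
Proof. by rewrite -cell_nil; elim: p => // i p IH /cell_parent. Qed.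

Lemma cell_level u k : 0 <= u < 1 -> exists2 p, size p = k & cell p u.
Proof.
move=> u01; elim: k => [|k [p pk pu]]; first by exists [::]; rewrite ?cell_nil.
by have [i iu] := cell_child pu; exists (i :: p) => //=; rewrite pk.
Qed.

Lemma piece_sub i p : piece (i :: p) `<=` piece p.
Proof. by apply: closure_subset; exact: (frag_sub (frag_path p)). Qed.

Lemma piece_cball i p : exists2 c, piece (i :: p) `<=` cball c (rad (size p)) &
  weight (i :: p) ^+ t <= mass mu (cball c (rad (size p))) ^+ t.-1.
Proof.
have [c sub le] := frag_cball (frag_path p) i; exists c => //.
by rewrite [cball _ _](closure_id _).1; [exact: closure_subset|exact: closed_cball].
Qed.

Lemma piece_diam i p x y : piece (i :: p) x -> piece (i :: p) y ->
  mdist x y <= 2 * rad (size p).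
Proof.
have [c sub _] := piece_cball i p; move=> /sub xc /sub yc.
have := metric_triangle x c y; rewrite (metric_sym c) => /le_trans; apply.
by move: xc yc; rewrite /cball /=; lra.
Qed.

(** The ancestors at the level where the paths part are siblings, separated at a scale no finer than
    that of level [k]. *)
Lemma frag_sep_path k p q x y : size p = k.+1 -> size q = k.+1 -> p <> q ->
  (frag p).1 x -> (frag q).1 y -> rad k / (2 * t%:R) <= mdist x y.
Proof.
elim: k p q => [|k IH] [//|i p] [//|j q] /= [pk] [qk] pq.
  move: p q pk qk pq => [|//] [|//] _ _ ij.
  by apply: (frag_sep (frag_path [::])) => ji; apply: ij; rewrite ji.
have [pq'|pq'] := eqVneq p q.
  subst q; rewrite -pk; apply: (frag_sep (frag_path p)) => ij.
  by apply: pq; rewrite ij.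
move=> /(frag_sub (frag_path p)) px /(frag_sub (frag_path q)) qy.
apply: le_trans (IH _ _ pk qk _ px qy); last exact/eqP.
rewrite ler_wpM2r ?invr_ge0 ?mulr_ge0// radS.
by have := rad_gt0 k; lra.
Qed.

Lemma piece_sep k p q x y : size p = k.+1 -> size q = k.+1 -> p <> q ->
  piece p x -> piece q y -> rad k / (2 * t%:R) <= mdist x y.
Proof.
move=> pk qk pq /closure_mdistP px /closure_mdistP qy.
apply/ler_addgt0Pr => e e0; have e2 : 0 < e / 2 by lra.
have [x' px' xx'] := px _ e2; have [y' qy' yy'] := qy _ e2.
have := frag_sep_path pk qk pq px' qy'.
have := metric_triangle x' x y'; have := metric_triangle x y y'.
by rewrite (metric_sym x' x); lra.
Qed.

Lemma sep_gt0 k : 0 < rad k / (2 * t%:R).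
Proof. by rewrite divr_gt0 ?rad_gt0// mulr_gt0// ltr0n. Qed.

Lemma piece_eq k p q x y : size p = k.+1 -> size q = k.+1 ->
  mdist x y < rad k / (2 * t%:R) -> piece p x -> piece q y -> p = q.
Proof.
move=> pk qk xy px qy; apply: contrapT => pq.
by have := piece_sep pk qk pq px qy; rewrite leNgt xy.
Qed.

Definition skeleton : set X := [set x | forall k, exists2 p, size p = k & piece p x].

(** Pieces of one level [k.+1] are closed and uniformly separated, so points of the skeleton close
    enough to [x] all lie in a single one, which then contains [x]. Level 0 follows from level 1. *)
Lemma closed_skeleton : closed skeleton.
Proof.
move=> x /closure_mdistP cx; suff H k : exists2 p, size p = k.+1 & piece p x.
  case=> [|k]; last exact: H.
  by have [[|i p] // _ /piece_sub px] := H 0%N; exists [::] => //; apply: subset_closure.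
have s0 := sep_gt0 k; pose e := rad k / (2 * t%:R) / 2.
have e0 : 0 < e by rewrite /e; lra.
have [y /(_ k.+1)[p pk py] xy] := cx e e0; exists p => //.
have -> : piece p = closure (piece p) by apply/closure_id; exact: closed_closure.
apply/closure_mdistP => d d0.
have m0 : 0 < Num.min d e by rewrite lt_min d0 e0.
have [z /(_ k.+1)[q qk qz]] := cx _ m0; rewrite lt_min => /andP[xz xze].
exists z => //; have yz : mdist y z < rad k / (2 * t%:R).
  have := metric_triangle y x z; rewrite (metric_sym y x); move: xy xze; rewrite /e; lra.
by rewrite (piece_eq pk qk yz py qz).
Qed.

Lemma compact_skeleton : compact skeleton.
Proof. exact: subclosed_compact closed_skeleton cX (@subsetT _ _). Qed.

(** Choose [k] with [2 * rad k < mdist x y <= 8 * rad k]. If the bound failed, [s] would be below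
    the separation at level [k.+1], and the chain would stay in one piece, of diameter at most
    [2 * rad k]. *)
Lemma skeleton_stretch : stretch_le skeleton (16 * t%:R).
Proof.
move=> s x y s0 c; rewrite leNgt; apply/negP => sxy.
have t0 : 0 < t%:R :> R by rewrite ltr0n.
have ts : 0 <= 16 * t%:R * s by rewrite !mulr_ge0.
have [|k /andP[k1 k2]] := @rad_scale (mdist x y).
  by rewrite (le_lt_trans ts sxy) /=; have := diamX x y; move: r0_gt0; lra.
have sk : s < rad k / (2 * t%:R).
  by rewrite ltr_pdivlMr ?mulr_gt0//; lra.
suff [[|i p] [] // [pk] px py] : exists p, [/\ size p = k.+1, piece p x & piece p y].
  by have := piece_diam px py; rewrite pk leNgt k1.
elim: c {sxy k1 k2} => [{}x|{}x {}y z] /(_ k.+1)[p pk px]; first by exists p.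
by move=> xy _ [q [qk qy qz]]; exists p; split=> //;
  rewrite (piece_eq pk qk (le_lt_trans xy sk) px qy).
Qed.

(** Pick a point in the fragment of each level whose cell contains [u]. The sequence is eventually
    in each of these nested fragments, so a cluster point lies in all their closures. *)
Lemma cell_point u : 0 <= u < 1 -> exists x, forall p, cell p u -> piece p x.
Proof.
move=> u01; have ex k : exists y, forall p, size p = k -> cell p u -> (frag p).1 y.
  have [p pk pu] := cell_level k u01; have [y py] := cell_nonempty pu.
  by exists y => q qk qu; rewrite -(cell_inj (etrans pk (esym qk)) pu qu).
have [y yP] := choice ex.
have cat n p : cell p u -> exists2 q, size q = n & cell (q ++ p) u.
  move=> pu; elim: n => [|n [q qn qu]]; first by exists [::].
  by have [i iu] := cell_child qu; exists (i :: q) => //=; rewrite qn.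
have cat_sub q p : (frag (q ++ p)).1 `<=` (frag p).1.
  elim: q => [|i q IH] //=; apply: subset_trans IH.
  exact: (frag_sub (frag_path (q ++ p))).
have [x [_ xP]] : setT `&` cluster (y @ \oo) !=set0 by apply: cX; exact: filterT.
exists x => p pu; move=> B xB.
have : (y @ \oo) (frag p).1.
  exists (size p) => // n /= pn; have [q qn qu] := cat (n - size p)%N p pu.
  by apply: (cat_sub q p); apply: yP qu; rewrite size_cat qn subnK.
by move=> /xP /(_ xB).
Qed.

Definition code (u : R) : X := get [set x | forall p, cell p u -> piece p x].

Lemma codeP p u : cell p u -> piece p (code u).
Proof.
have [u01|/negP u01] := boolP (0 <= u < 1).
  have [x xP] := cell_point u01.
  exact: (@getI _ [set x | forall p, cell p u -> piece p x] x xP p).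
by move=> /cell01.
Qed.

Lemma code_skeleton u : 0 <= u < 1 -> skeleton (code u).
Proof.
by move=> u01 k; have [p pk /codeP] := cell_level k u01; exists p.
Qed.

Lemma measurable_cell p : measurable (cell p).
Proof.
rewrite (_ : cell p = `[start p, start p + weight p[%classic) //.
Qed.

(** Pieces shrink with the level, so [code u] is in the closed set [A] as soon as its piece meets
    [A] at every level. The right-hand side is built from countably many intervals. *)
Lemma preimage_code (A : set X) : closed A ->
  `[0, 1[%classic `&` code @^-1` A = `[0, 1[%classic `&`
    \bigcap_k \bigcup_(p in [set p | size p = k.+1 /\ piece p `&` A !=set0]) cell p.
Proof.
move=> cA; apply/seteqP; split=> u [/=]; rewrite in_itv /= => u01 uA; split=> //.
  move=> k _; have [p pk pu] := cell_level k.+1 u01; exists p => //.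
  by split=> //; exists (code u); split=> //; exact: codeP.
apply: cA; apply/closure_mdistP => e e0.
have m0 : 0 < Num.min e (2 * r0) <= 2 * r0.
  by rewrite lt_min e0 ge_min lexx orbT andbT /=; move: r0_gt0; lra.
have [k /andP[]] := rad_scale m0; rewrite lt_min => /andP[ke _ _].
have [[|i p] [[] // [pk] [y [py Ay]]] /codeP pu] := uA k I.
by exists y => //; apply: le_lt_trans (piece_diam pu py) _; rewrite pk.
Qed.

Lemma measurable_code : measurable_fun setT (code : R -> borel X).
Proof.
have D01 : measurable (`[0, 1[%classic : set R) by exact: measurable_itv.
have cl (A : set X) : closed A -> measurable (code @^-1` A).
  move=> cA; rewrite -[code @^-1` A](setUIDK _ `[0, 1[%classic).
  apply: measurableU.
    rewrite setIC preimage_code//; apply: measurableI => //.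
    apply: bigcap_measurable => // k _.
    rewrite bigcup_mkcond; apply: countable_bigcupT_measurable; first exact: countableP.
    by move=> p; case: ifP => _; [exact: measurable_cell|exact: measurable0].
  (* Off [0, 1) no cell contains [u], so [code] is constant there and the preimage contains all of
     the complement or none of it. *)
  have codeE u : ~ 0 <= u < 1 -> code u = get setT.
    by move=> u01; rewrite /code; congr get; apply/seteqP; split=> // x _ p /cell01.
  have [gA|gA] := pselect (A (get setT)).
    rewrite [X in measurable X](_ : _ = ~` `[0, 1[%classic); first exact: measurableC.
    apply/seteqP; split=> [u []//|u u01]; split=> //=.
    by rewrite codeE//; move: u01; rewrite /= in_itv.
  rewrite [X in measurable X](_ : _ = set0); first exact: measurable0.
  apply/seteqP; split=> // u [/= uA u01]; apply: gA.
  by rewrite -(codeE u)//; move: u01; rewrite in_itv.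
apply: (@measurability _ _ R (borel X) setT code (@open X)) => // _ [A oA <-].
rewrite setTI.
rewrite -[A]setCK preimage_setC; apply: measurableC.
exact: (cl (~` A) (open_closedC oA)).
Qed.
Definition code_rv : measurableTypeR R -> borel X := code.

HB.instance Definition _ :=
  isMeasurableFun.Build _ _ (measurableTypeR R) (borel X) code_rv measurable_code.

Definition skeleton_measure : probability (borel X) R :=
  distribution (@lebesgue01 R) code_rv.

Lemma skeleton_measureE (A : set X) :
  skeleton_measure A = lebesgue_measure (code @^-1` A `&` `[0, 1[%classic).
Proof. by []. Qed.

Lemma skeleton_measure1 : skeleton_measure skeleton = 1%E.
Proof.
rewrite -(lebesgue01_setT R) skeleton_measureE /lebesgue01 /mrestr setTI.
congr lebesgue_measure; apply/setIidr => u /=; rewrite in_itv /=.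
exact: code_skeleton.
Qed.

(** The ball has diameter below the separation at level [k.+1], so its preimage in [0, 1) lies in
    one cell, whose length is the weight of the piece. The ball [B(c, rad k)] around that piece lies
    in [B(x, r + 2 * rad k)]. *)
Lemma skeleton_measure_cball x r k : 4 * t%:R * r < rad k ->
  mass skeleton_measure (cball x r) ^+ t <=
  mass mu (cball x (r + 2 * rad k)) ^+ t.-1.
Proof.
move=> rk; have t0 : 0 < t%:R :> R by rewrite ltr0n.
have rs : 2 * r < rad k / (2 * t%:R) by rewrite ltr_pdivlMr ?mulr_gt0//; lra.
have mB := @cball_borel R X x r.
have [[u [u01 ux]]|no] := pselect (exists u, 0 <= u < 1 /\ cball x r (code u)); last first.
  rewrite /mass skeleton_measureE [X in lebesgue_measure X](_ : _ = set0).
    by rewrite measure0 /= expr0n gtn_eqF// exprn_ge0// mass_ge0.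
  apply/seteqP; split=> // u [/= ux]; rewrite in_itv /= => u01.
  by apply: no; exists u.
have [[|i p] // [pk] pu] := cell_level k.+1 u01.
have [c sub le] := piece_cball i p; rewrite pk in sub le.
apply: (@le_trans _ _ (weight (i :: p) ^+ t)).
  rewrite lerXn2r ?nnegrE ?mass_ge0 ?weight_ge0// -lee_fin -massE//.
  rewrite skeleton_measureE.
  have -> : (weight (i :: p))%:E = lebesgue_measure (cell (i :: p)).
    rewrite (_ : cell _ = `[start (i :: p), start (i :: p) + weight (i :: p)[%classic)//.
    rewrite lebesgue_measure_itv /= lte_fin ltrDl -EFinB addrAC subrr add0r.
    by rewrite lt_neqAle weight_ge0 andbT eq_sym; case: eqP => [->|].
  apply: le_measure; rewrite ?inE; [|exact: measurable_cell|].
    apply: measurableI; last exact: measurable_itv.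
    rewrite -[_ @^-1` _]setTI; apply: measurable_code => //.
  move=> v [/= vx]; rewrite in_itv /= => v01.
  have [q qk qv] := cell_level k.+1 v01.
  suff -> : i :: p = q by [].
  apply: (piece_eq (k := k) (x := code u) (y := code v)) => //=.
  - by rewrite pk.
  - move: ux vx rs; rewrite /cball /=.
    by have := metric_triangle (code u) x (code v); rewrite (metric_sym x); lra.
  - exact: codeP.
  - exact: codeP.
apply: le_trans le _; rewrite lerXn2r ?nnegrE ?mass_ge0//.
apply: mass_le; [exact: cball_borel|exact: cball_borel|].
apply: cball_sub; have := sub _ (codeP pu); move: ux; rewrite /cball /=.
by have := metric_triangle c (code u) x; rewrite (metric_sym c (code u)); lra.
Qed.
End Tree.

(** * The case of one measure *)

Lemma bounded_diam (R : realType) (X : pmetricType R) : compact [set: X] ->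
  exists2 r0 : R, 0 < r0 & forall x y : X, mdist x y <= r0.
Proof.
move=> cX; have [s sP] := finite_net cX (@ltr01 R).
pose M := 1 + \sum_(z <- s) mdist z point.
have M1 : 1 <= M by rewrite lerDl sumr_ge0// => z _; exact: mdist_ge0.
have xM (x : X) : mdist x point <= M.
  have [z zs xz] := sP x; apply: le_trans (metric_triangle _ z _) _.
  rewrite lerD// (big_rem z)//= lerDl sumr_ge0// => w _; exact: mdist_ge0.
exists (2 * M) => [|x y]; first by lra.
have := metric_triangle x point y; rewrite (metric_sym point).
by have := xM x; have := xM y; lra.
Qed.

Lemma le_powR_of_le_expr (R : realType) (a b e : R) (t : nat) :
  (0 < t)%N -> 0 <= a -> 0 <= b <= 1 -> e < 1 -> 1 <= t%:R * e ->
  a ^+ t <= b ^+ t.-1 -> a <= b `^ (1 - e).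
Proof.
move=> t0 a0 /andP[b0 b1] e1 te ab.
have tR : 0 < t%:R :> R by rewrite ltr0n.
(* If [b = 0], then [e < 1] forces [t >= 2], so [b ^ (t - 1) = 0] and [a = 0]. Otherwise
   [a <= b ^ (1 - 1 / t) <= b ^ (1 - e)], as [b <= 1] and [1 / t <= e]. *)
have [bE|bn] := eqVneq b 0.
  have t1 : (0 < t.-1)%N.
    by case: t t0 te {ab tR} => [//|[|//]] _; rewrite mul1r leNgt e1.
  move: ab; rewrite bE powR0 ?subr_eq0 ?gt_eqF// expr0n gtn_eqF//.
  by apply: contraTT; rewrite -!ltNge; exact: exprn_gt0.
have {}bn : 0 < b by rewrite lt_neqAle eq_sym bn.
have aE : a = (a ^+ t) `^ t%:R^-1.
  by rewrite -powR_mulrn// -powRrM mulfV ?powRr1// gt_eqF.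
rewrite aE; apply: le_trans (_ : (b ^+ t.-1) `^ t%:R^-1 <= _).
  by rewrite ge0_ler_powR ?nnegrE ?invr_ge0 ?exprn_ge0// ltW.
rewrite -powR_mulrn// -powRrM; apply: ger_powR; first by rewrite bn b1.
rewrite ler_pdivlMr// -[in leRHS](prednK t0) -natr1 in te *.
by move: te; rewrite -(prednK t0) -natr1; lra.
Qed.

(** Continuity from above, for the case of radius 0, where no single scale is fine enough. *)
Lemma mass_cball_cvg (R : realType) (X : pmetricType R) (mu : probability (borel X) R)
    (x : X) (r0 : R) : 0 < r0 ->
  mass mu (cball x (2 * rad r0 k)) @[k --> \oo] --> mass mu (cball x 0).
Proof.
move=> r0_gt0; apply: fine_cvg; rewrite -massE; last exact: cball_borel.
have -> : cball x 0 = \bigcap_k cball x (2 * rad r0 k).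
  apply/seteqP; split=> [y /= yx k _|y /= yx].
    by rewrite /cball /=; apply: le_trans yx _; have := rad_gt0 r0_gt0 k; lra.
  rewrite /cball /= leNgt; apply/negP => d0.
  have m0 : 0 < Num.min (mdist y x) (2 * r0) <= 2 * r0.
    by rewrite lt_min d0 ge_min lexx orbT andbT /=; lra.
  have [k /andP[]] := rad_scale m0; rewrite lt_min => /andP[kd _] _.
  by have := yx k I; rewrite /cball /= leNgt kd.
apply: (nonincreasing_cvg_mu (mu := mu) (F := fun k => cball x (2 * rad r0 k))).
- by rewrite ltey_eq fin_num_measure//; exact: cball_borel.
- by move=> k; exact: cball_borel.
- by apply: bigcap_measurable => // k _; exact: cball_borel.
- apply/nonincreasing_seqP => k; apply/subsetPset; apply: cball_sub.
  by rewrite mdistxx add0r radS; have := rad_gt0 r0_gt0 k; lra.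
Qed.

Lemma ultrametric_skeleton (R : realType) (e : R) : 0 < e < 1 ->
  exists C : R, 0 < C /\ property_P e 32 C.
Proof.
(* With this choice [1 / e < t <= 2 / e], so the distortion [16 * t] is at most [32 / e]. *)
move=> /andP[e0 e1]; pose t := (Num.truncn e^-1).+1.
have t0 : (0 < t)%N by [].
have tR : 0 < t%:R :> R by rewrite ltr0n.
have te : 1 <= t%:R * e.
  by rewrite -ler_pdivrMr// mul1r ltW// truncnS_gt.
have t2e : t%:R <= 2 / e.
  have e1' : 1 <= e^-1 by rewrite invf_ge1// ltW.
  rewrite /t -natr1; have : (Num.truncn e^-1)%:R <= e^-1 by rewrite truncn_le; lra.
  by lra.
(* For [2 * rad k < 33 * t * r <= 8 * rad k], both [4 * t * r < rad k] and
   [r + 2 * rad k <= (33 * t + 1) * r] hold. If no such [k] exists because [33 * t * r > 2 * r0],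
   the larger ball is all of [X]. *)
exists (33 * t%:R + 1); split; first by lra.
move=> X mu cX; have [r0 r0_gt0 diamX] := bounded_diam cX.
have exF (kY : nat * fragment X) : exists l, light mu t (rad r0 kY.1) kY.2 ->
    fragmentation mu t (rad r0 kY.1) kY.2 l.
  have [lY|nY] := pselect (light mu t (rad r0 kY.1) kY.2); last by exists [::].
  have [l lP] := exists_fragmentation t0 cX (rad_gt0 r0_gt0 _) lY.
  by exists l.
have [F' F'P] := choice exF; pose F k Y := F' (k, Y).
have FP k Y : light mu t (rad r0 k) Y -> fragmentation mu t (rad r0 k) Y (F k Y).
  exact: (F'P (k, Y)).
pose S := skeleton F.
exists S; split.
- exact: (compact_skeleton t0 r0_gt0 cX FP).
- apply: stretch_embeds_ultrametric; first by rewrite ler_pdivlMr//; lra.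
  move=> s x y s0 c; apply: le_trans (skeleton_stretch t0 r0_gt0 diamX FP s0 c) _.
  by rewrite ler_wpM2r//; lra.
pose nu := skeleton_measure r0_gt0 cX FP.
exists nu; split; first exact: skeleton_measure1.
move=> x r r_ge0.
have mB y q : measurable (cball y q : set (borel X)) by exact: cball_borel.
have nuB k : 4 * t%:R * r < rad r0 k -> mass nu (cball x r) ^+ t <=
    mass mu (cball x (r + 2 * rad r0 k)) ^+ t.-1.
  exact: skeleton_measure_cball.
rewrite !massE// poweR_EFin lee_fin.
apply: (le_powR_of_le_expr t0) => //; rewrite ?mass_ge0 ?mass_le1//.
have [rE|r_neq0] := eqVneq r 0.
  have cv : (mass mu (cball x (2 * rad r0 k)) ^+ t.-1) @[k --> \oo] -->
      mass mu (cball x 0) ^+ t.-1.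
    apply: (@continuous_cvg _ _ _ _ _ _ (fun z : R => z ^+ t.-1)).
      exact: exprn_continuous.
    exact: mass_cball_cvg.
  rewrite rE mulr0; apply: (cvgr_to_ge cv); apply: nearW => k.
  by have := nuB k; rewrite rE mulr0 add0r; apply; exact: rad_gt0.
have r_gt0 : 0 < r by rewrite lt_neqAle eq_sym r_neq0.
have tr : 0 < t%:R * r by rewrite mulr_gt0.
have [big|small] := ltP (2 * r0) (33 * t%:R * r).
  rewrite [X in _ <= mass _ X ^+ _](_ : _ = setT).
    rewrite massT expr1n exprn_ile1 ?mass_ge0//.
    exact: mass_le1.
  by apply/seteqP; split=> // y _; rewrite /cball /=; have := diamX y x; lra.
have [|k /andP[k1 k2]] := @rad_scale _ r0 (33 * t%:R * r).
  by rewrite small andbT; lra.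
apply: le_trans (nuB k _) _; first by lra.
rewrite lerXn2r ?nnegrE ?mass_ge0//; apply: mass_le => //.
by apply: cball_sub; rewrite mdistxx; lra.
Qed.

(** * Several measures *)

Theorem corollary1p5 (R : realType) :
  (exists K : R, 0 < K /\
     forall e : R, 0 < e < 1 -> exists C : R, 0 < C /\ property_P e K C)
  /\
  (forall K : R, 0 < K ->
   exists K' : R, 0 < K' /\
   forall C : R -> R,
     (forall e : R, 0 < e < 1 -> 0 < C e /\ property_P e K (C e)) ->
   forall (e : R) (k : nat), 0 < e < 1 -> (1 <= k)%N ->
   forall (X : pmetricType R) (mu : 'I_k -> probability (borel X) R),
     compact [set: X] ->
   exists S : set X, compact S /\
   (exists D : R, D <= (K' / e) ^+ k /\ embeds_ultrametric S D) /\
   exists nu : 'I_k -> probability (borel X) R,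
     (forall i, nu i S = 1%E) /\
     forall (x : X) (r : R), 0 <= r -> forall i : 'I_k,
       (nu i (cball x r) <= mu i (cball x (C e * r)) `^ (1 - e))%E).
Proof.
split; first by exists 32; split=> //; exact: ultrametric_skeleton.
(* As [e < 1], [K / e + 2 <= (K + 2) / e]. *)
move=> K K0; exists (K + 2); split; first by lra.
move=> C CP e [//|k] e01 _ X mu cX; have /andP[e0 e1] := e01.
have [S' S'P] := choice (fun i => (CP e e01).2 X (mu i) cX).
(* Natural indices, as in the bound for unions; [inord] is only evaluated usefully at [n <= k]. *)
pose S n := S' (inord n).
have S'S i : S' i `<=` \bigcup_(n < k.+1) S n.
  by move=> x Sx; exists (val i); [exact: ltn_ord|rewrite /S inord_val].
have cS : compact (\bigcup_(n < k.+1) S n).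
  rewrite bigcup_mkord; apply: bigsetU_compact => i _.
  by case: (S'P (inord i)).
exists (\bigcup_(n < k.+1) S n); split=> //; split.
  exists ((K / e + 2) ^+ k.+1 - 2); split; last first.
    by apply: embeds_ultrametric_bigU => i _; case: (S'P (inord i)).
  have Ke : 0 < K / e by rewrite divr_gt0.
  apply: le_trans (_ : (K / e + 2) ^+ k.+1 <= _); first by lra.
  rewrite lerXn2r ?nnegrE ?divr_ge0//; try lra.
  by rewrite mulrDl lerD2l ler_pdivlMr//; lra.
have exnu i : exists nu : probability (borel X) R, nu (S' i) = 1%E /\
    forall (x : X) (r : R), 0 <= r ->
    (nu (cball x r) <= mu i (cball x (C e * r)) `^ (1 - e))%E.
  by case: (S'P i).
have [nu nuP] := choice exnu.
have mS (A : set X) : compact A -> measurable (A : set (borel X)).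
  move=> cA; apply: closed_borel; apply: (@compact_closed X) => //.
  exact: (@metric_hausdorff R X).
exists nu; split=> [i|x r r0 i]; last exact: (nuP i).2.
apply: le_anti; rewrite probability_le1 ?andTb; last exact: mS.
apply: (@le_trans _ _ (nu i (S' i))); first by rewrite (nuP i).1.
apply: le_measure; rewrite ?inE; [|exact: mS|exact: S'S].
by apply: mS; case: (S'P i).
Qed.
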